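(* Let $\tilde w\in\tilde S_{n,k}$ be a decorated permutation with associated Grassmann interval $[u,v]$ and associated positroid $\mathcal M=\mathcal M(\tilde w)$. Then $\mathcal M$ is exactly the collection of initial sets of permutations in $[u,v]$: $$\mathcal M=\{y[k] : y\in[u,v]\}.$$
   Context: $[n]=\{1,\dots,n\}$; $\binom{[n]}{k}$ is the set of $k$-subsets. For $r\in[n]$ let $<_r$ be the linear order $r<_r r+1<_r\dots<_r n<_r 1<_r\dots<_r r-1$ on $[n]$. For $k$-subsets $I=\{i_1<_r\dots<_r i_k\}$, $J=\{j_1<_r\dots<_r j_k\}$ write $I\preceq_r J$ if $i_h\le_r j_h$ for all $h$; $\preceq$ means $\preceq_1$. For $w\in S_n$, $w[i]=\{w(1),\dots,w(i)\}$. Bruhat order: $u\le v$ iff $u[i]\preceq v[i]$ for all $i$; $[u,v]=\{y\in S_n:u\le y\le v\}$. Products of permutations are compositions, $(wv)(i)=w(v(i))$. A decorated permutation on $[n]$ is a pair $\tilde w=(w,\mathrm{co})$ with $w\in S_n$ and $\mathrm{co}$ a map from the fixed points of $w$ to $\{\text{clockwise},\text{counterclockwise}\}$. For $r\in[n]$, its shifted anti-exceedance set is $I_r(\tilde w)=\{i\in[n]: i<_r w^{-1}(i)\}\cup\{i: w(i)=i,\ \mathrm{co}(i)=\text{clockwise}\}$. All $I_r(\tilde w)$ have the same size $k(\tilde w)$; $\tilde S_{n,k}$ is the set of decorated permutations on $[n]$ with $k(\tilde w)=k$. Associated Grassmann interval of $\tilde w\in\tilde S_{n,k}$: $v$ is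 the $k$-Grassmannian permutation ($v_1<\dots<v_k$, $v_{k+1}<\dots<v_n$) with $v[k]=w^{-1}(I_1(\tilde w))$, and $u=wv$; then $u\le v$ and $u[k]=I_1(\tilde w)$. Associated positroid: $\mathcal M(\tilde w)=\{I\in\binom{[n]}{k}: I_r(\tilde w)\preceq_r I\text{ for all } r\in[n]\}$. *)

(* Defs.v *)
From mathcomp Require Export all_boot all_fingroup.

Set Implicit Arguments.
Unset Strict Implicit.
Unset Printing Implicit Defensive.

Local Open Scope group_scope.

(* The set [n] = {1, ..., n} is represented by 'I_n, so every index is shifted
   down by one; in particular the order <_1 is the one with r = 0. *)

Section CyclicOrders.

Variable n : nat.

(* [cyc_pos r i] is the 0-based rank of i in the list
   r, r + 1, ..., n - 1, 0, ..., r - 1.  The base point r is a nat, meant to be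
   < n, so that the base point 0 can be written without assuming 0 < n. *)
Definition cyc_pos (r : nat) (i : 'I_n) : nat := (i + (n - r)) %% n.

Definition cyc_le (r : nat) : rel 'I_n := fun i j => cyc_pos r i <= cyc_pos r j.
Definition cyc_lt (r : nat) : rel 'I_n := fun i j => cyc_pos r i < cyc_pos r j.

(* The componentwise order on subsets of the same size; [all2] is false on
   lists of different lengths. *)
Definition gale_le (r : nat) (I J : {set 'I_n}) : bool :=
  all2 (cyc_le r) (sort (cyc_le r) (enum I)) (sort (cyc_le r) (enum J)).

(* w[i] = {w(1), ..., w(i)} *)
Definition initial_set (w : 'S_n) (i : nat) : {set 'I_n} :=
  w @: [set j : 'I_n | j < i].

(* The initial sets compared are u[1], ..., u[n], hence the successor. *)
Definition bruhat_le (u v : 'S_n) : bool :=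
  [forall i : 'I_n, gale_le 0 (initial_set u i.+1) (initial_set v i.+1)].

Definition bruhat_interval (u v : 'S_n) : {set 'S_n} :=
  [set y | bruhat_le u y && bruhat_le y v].

End CyclicOrders.

Inductive decoration := Clockwise | Counterclockwise.

Definition is_clockwise (c : decoration) : bool :=
  if c is Clockwise then true else false.

Record decorated_perm (n : nat) := DecoratedPerm {
  dperm :> 'S_n;
  dco : {i : 'I_n | dperm i == i} -> decoration
}.

Section DecoratedPermutations.

Variables (n : nat) (w : decorated_perm n).

(* [insub i] is [Some] of the fixed point i when w i == i, and [None]
   otherwise. *)
Definition clockwise_fixed (i : 'I_n) : bool :=
  if insub i is Some x then is_clockwise (@dco n w x) else false.

Definition anti_exceedance (r : nat) : {set 'I_n} :=
  [set i | cyc_lt r i ((dperm w)^-1 i)] :|: [set i | clockwise_fixed i].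

(* All the sets [anti_exceedance r], r < n, have the same size. *)
Definition dperm_rank : nat := #|anti_exceedance 0|.

Definition positroid (k : nat) : {set {set 'I_n}} :=
  [set I : {set 'I_n} |
    (#|I| == k) && [forall r : 'I_n, gale_le r (anti_exceedance r) I]].

End DecoratedPermutations.

Definition k_grassmannian (n k : nat) (v : 'S_n) : Prop :=
  (forall i j : 'I_n, i < j -> j < k -> v i < v j) /\
  (forall i j : 'I_n, k <= i -> i < j -> v i < v j).

(* [v * dperm w] maps i to w (v i): in MathComp the left factor of a product of
   permutations acts first, so this is the composition w o v. *)
Definition grassmann_interval (n k : nat) (w : decorated_perm n)
    (u v : 'S_n) : Prop :=
  [/\ k_grassmannian k v,
      initial_set v k = (dperm w)^-1 @: anti_exceedance w 0
    & u = v * dperm w].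

(* Main.v *)
Require Import Defs.
From mathcomp Require Import zify.

Set Implicit Arguments.
Unset Strict Implicit.
Unset Printing Implicit Defensive.

Local Open Scope group_scope.

(** Write I_1 for the anti-exceedance set at the first base point. Both sets
    turn out to consist of the sets [y[k]] for permutations [y] whose values
    lie between those of [u] and [v], that is, [u p <= y p <= v p] for [p < k]
    and [v p <= y p <= u p] for [p >= k]; the bridge is a system of counting
    inequalities on intervals.

    Positroid side. A componentwise comparison of sets at base point [r]
    compares cardinals of initial segments of the cyclic order. Such a segment
    is either an interval or the complement of one, and the anti-exceedances
    at [r] inside an interval starting or ending at [r] have a direct
    description in terms of I_1 and w^-1. So [I] of size [k] is in the positroid
    iff for all [b <= c <= n] (lemma [positroidP]):
    - [I] has at least as many points in [[b, c)] as there are [i] in I_1 with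
      [b <= i <= w^-1 i < c];
    - the complement of [I] has at least as many points in [[b, c)] as there
      are [i] outside I_1 with [b <= w^-1 i <= i < c].
    As I_1 = [u[k]] and [w^-1 (u p) = v p], the intervals counted are those
    spanned by [u p] and [v p], with [p < k] in the first case and [p >= k] in
    the second.

    From the positroid to the interval. The inequalities are Hall's condition
    for matching these intervals with points of [I], resp. of its complement.
    For intervals this condition suffices ([interval_matching]), and the two
    matchings together form a permutation [y] between [u] and [v] with
    [y[k] = I]. Such a [y] is in [[u, v]] because pointwise inequalities
    in opposite directions on the two blocks imply the Bruhat inequality
    ([bruhat_le_pointwise]).

    From the interval to the positroid. As [v] increases on both blocks, the
    positions [p < k] with [v p < c] form an initial segment, as do the
    positions left out by the conditions [p >= k] and [b <= v p]. The Bruhat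
    inequalities [u <= y <= v] at the end of this one segment give the
    inequality for [[b, c)] ([interval_count_below], [interval_count_above]). *)

(** * Componentwise orders as counting conditions *)

(** For sorted lists, comparing entries is comparing counts below every
    threshold [t]: the threshold just above the head of [s2] recovers the
    comparison of the heads. *)
Lemma all2_leq_count (s1 s2 : seq nat) :
  sorted leq s1 -> sorted leq s2 ->
  all2 leq s1 s2 <-> size s1 = size s2 /\
    forall t, count (fun x => x < t) s2 <= count (fun x => x < t) s1.
Proof.
elim: s1 s2 => [|x s1 IH] [|y s2] //=; try by split=> // -[].
move=> px py.
have /allP minx := order_path_min leq_trans px.
have /allP miny := order_path_min leq_trans py.
have {}IH := IH s2 (path_sorted px) (path_sorted py).
split=> [/andP[xy /IH[-> le_count]] | [[eq_size] le_count]].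
  by split=> // t; apply: leq_add (le_count t); lia.
have xy : x <= y.
  rewrite leqNgt; apply/negP => yx.
  have := le_count y.+1; have -> : x < y.+1 = false by lia.
  rewrite leqnn /=.
  rewrite [X in _ <= X](@eq_in_count _ _ pred0) ?count_pred0 // => z /minx /=.
  lia.
rewrite xy; apply/IH; split=> // t.
have [ty|yt] := leqP t y; last by have := le_count t; lia.
by rewrite (@eq_in_count _ _ pred0) ?count_pred0 // => z /miny /=; lia.
Qed.

Lemma gale_leP n r (I J : {set 'I_n}) :
  reflect (#|I| = #|J| /\ forall t, #|[set i in J | cyc_pos r i < t]|
                                    <= #|[set i in I | cyc_pos r i < t]|)
          (gale_le r I J).
Proof.
pose ranks (A : {set 'I_n}) := sort leq (map (cyc_pos r) (enum A)).
have ranksE A : ranks A = map (cyc_pos r) (sort (cyc_le r) (enum A)).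
  by rewrite /ranks sort_map.
have size_ranks A : size (ranks A) = #|A|.
  by rewrite size_sort size_map -cardE.
have count_ranks A t :
    count (fun x => x < t) (ranks A) = #|[set i in A | cyc_pos r i < t]|.
  rewrite /ranks (seq.permP (permEl (perm_sort _ _))) count_map.
  rewrite -size_filter cardE; apply: perm_size; apply: uniq_perm.
  - by rewrite filter_uniq ?enum_uniq.
  - exact: enum_uniq.
  by move=> i; rewrite mem_filter !mem_enum !inE /= andbC.
have -> : gale_le r I J = all2 leq (ranks I) (ranks J).
  rewrite !ranksE /gale_le.
  by elim: (sort _ _) (sort _ _) => [|a s IH] [|b s'] //=; rewrite IH.
have sorted_ranks A : sorted leq (ranks A) := sort_sorted leq_total _.
have eqv := all2_leq_count (sorted_ranks I) (sorted_ranks J).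
rewrite !size_ranks in eqv.
apply: (iffP idP) => [/eqv[-> le_count] | [eq_card le_count]].
  by split=> // t; rewrite -!count_ranks.
by apply/eqv; split=> // t; rewrite !count_ranks.
Qed.

Lemma cyc_posE n r (i : 'I_n) : r <= n ->
  cyc_pos r i = if r <= i then i - r else i + (n - r).
Proof.
move=> le_rn; have lt_in := ltn_ord i; rewrite /cyc_pos.
case: leqP => [le_ri | lt_ir]; last by rewrite modn_small //; lia.
have -> : i + (n - r) = (i - r) + n by lia.
by rewrite modnDr modn_small //; lia.
Qed.

Lemma card_initial_set n (y : 'S_n) m (P : pred 'I_n) :
  #|[set i in initial_set y m | P i]| = #|[set p : 'I_n | (p < m) && P (y p)]|.
Proof.
rewrite -(card_imset [set p : 'I_n | _] (@perm_inj _ y)).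
apply: eq_card => i; rewrite inE; apply/andP/imsetP => [[/imsetP[p]]|[p]].
  by rewrite inE => lt_pm -> Py; exists p => //; rewrite inE lt_pm.
by rewrite inE => /andP[lt_pm Py] ->; split=> //; rewrite imset_f ?inE.
Qed.

Lemma card_initial_set_all n (y : 'S_n) m :
  #|initial_set y m| = #|[set p : 'I_n | p < m]|.
Proof. by rewrite card_imset //; apply: perm_inj. Qed.

Lemma bruhat_leP n (u v : 'S_n) :
  bruhat_le u v <-> forall m t, m <= n ->
    #|[set p : 'I_n | (p < m) && (v p < t)]|
    <= #|[set p : 'I_n | (p < m) && (u p < t)]|.
Proof.
have rank_count (y : 'S_n) m t :
    #|[set i in initial_set y m | cyc_pos 0 i < t]|
    = #|[set p : 'I_n | (p < m) && (y p < t)]|.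
  rewrite card_initial_set; apply: eq_card => p.
  by rewrite !inE cyc_posE //= subn0.
split=> [/forallP le_uv [|m] t lt_mn | le_uv].
  by rewrite eq_card0 // => p; rewrite inE ltn0.
  have /gale_leP[_ /(_ t)] := le_uv (Ordinal lt_mn).
  by rewrite !rank_count.
apply/forallP => m; apply/gale_leP; rewrite !card_initial_set_all; split=> // t.
by rewrite !rank_count; apply: le_uv.
Qed.

(** * Filling intervals with distinct points *)

(** Hall's theorem for intervals: it is enough to test Hall's condition on sets
    of intervals contained in a common interval. The matching is greedy: the
    least point [x] of [I] is given to the interval starting at or before [x]
    that ends first. The inequalities survive for the remaining points and
    intervals because [x] is the least point: if the chosen interval
    ends before [c] then the inequality for [[0, c)] has lost one on each side,
    and otherwise no interval starting at or before [x] ends before [c], so the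
    inequality for [[x + 1, c)] can be used. *)
Lemma interval_matching (T : finType) n (P : {set T}) (l h : T -> 'I_n)
    (I : {set 'I_n}) :
  (forall b c, c <= n -> #|[set p in P | (b <= l p) && (h p < c)]|
               <= #|[set i in I | b <= i < c]|) ->
  exists f : T -> 'I_n, {in P &, injective f} /\
    forall p, p \in P -> (f p \in I) && (l p <= f p <= h p).
Proof.
have [m] := ubnP #|I|; elim: m => // m IH in P I *.
move=> ltIm hall.
have [I0|[x0 Ix0]] := set_0Vmem I.
  have P0 p : p \in P -> false.
    move=> Pp; have := hall 0 n (leqnn n).
    rewrite (eq_card0 (A := [set i in I | _])) => [|i]; last by rewrite I0 !inE.
    rewrite leqn0 cards_eq0 => /eqP/setP/(_ p).
    by rewrite !inE Pp ltn_ord.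
  by exists h; split=> [p q /P0|p /P0].
have [x Ix minx] : exists2 x : 'I_n, x \in I & forall i, i \in I -> x <= i.
  by case: (arg_minnP (fun i : 'I_n => i : nat) Ix0) => x; exists x.
have ltI'm : #|I :\ x| < m by move: ltIm; rewrite (cardsD1 x) Ix.
have I'E b c : b <= x < c ->
    #|[set i in I | b <= i < c]| = #|[set i in I :\ x | b <= i < c]|.+1.
  move=> bxc; rewrite (cardsD1 x [set i in I | _]) [x \in _]inE Ix bxc.
  congr _.+1.
  by apply: eq_card => i; rewrite !inE -andbA.
have I'E0 b c : ~~ (b <= x < c) ->
    #|[set i in I | b <= i < c]| = #|[set i in I :\ x | b <= i < c]|.
  move=> bxc; apply: eq_card => i; rewrite !inE.
  by have [->|//] := eqVneq i x; rewrite (negPf bxc) andbF.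
(* The case where the intervals counted all start after [x]. *)
have right_hall b c (Q : {set T}) : Q \subset P -> c <= n -> b <= x < c ->
    (forall p, p \in Q -> b <= l p -> h p < c -> x < l p) ->
    #|[set p in Q | (b <= l p) && (h p < c)]|
    <= #|[set i in I :\ x | b <= i < c]|.
  move=> /subsetP sQP cn bxc Qx; have := hall x.+1 c cn.
  rewrite I'E0 ?ltnn // => hx; apply: leq_trans (leq_trans _ hx) _.
    apply: subset_leq_card; apply/subsetP => p; rewrite !inE.
    by case/and3P=> Qp bl hc; rewrite (sQP p Qp) hc (Qx p Qp bl hc).
  apply: subset_leq_card; apply/subsetP => i; rewrite !inE.
  by case/and3P=> -> xi ->; rewrite andbT /=; lia.
(* If no interval starts at or before [x], then [x] is simply discarded. *)
have [Px0|[p0]] := set_0Vmem [set p in P | l p <= x].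
  have no_l p : p \in P -> x < l p.
    by move=> Pp; have /setP/(_ p) := Px0; rewrite !inE Pp /=; lia.
  have [b c cn|f [injf fI]] := IH P (I :\ x) ltI'm.
    have [bxc|bxc] := boolP (b <= x < c); last by rewrite -I'E0 ?hall.
    by apply: right_hall => // p Pp _ _; apply: no_l.
  by exists f; split=> // p /fI; rewrite !inE => /andP[/andP[_ ->]].
rewrite inE => Pl0.
have [q /andP[Pq lq] minq] : exists2 q, (q \in P) && (l q <= x) &
    forall p, p \in P -> l p <= x -> h q <= h p.
  case: (arg_minnP (P := fun p => (p \in P) && (l p <= x)) h Pl0) => q Pq minq.
  by exists q => // p Pp lp; apply: minq; rewrite Pp.
have [b c cn|f [injf fI]] := IH (P :\ q) (I :\ x) ltI'm.
  have [bxc|bxc] := boolP (b <= x < c); last first.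
    rewrite -I'E0 //; apply: leq_trans (hall b c cn); apply: subset_leq_card.
    by apply/subsetP => p; rewrite !inE => /andP[/andP[_ ->]].
  have [hqc|hqc] := ltnP (h q) c; last first.
    apply: right_hall => //; first exact: subD1set.
    move=> p; rewrite !inE => /andP[_ Pp] bl hc.
    rewrite ltnNge; apply/negP => lx.
    by have := minq p Pp lx; lia.
  have := hall 0 c cn; rewrite (cardsD1 q) [q \in _]inE Pq hqc I'E; last by lia.
  rewrite ltnS => hall0; apply: leq_trans (leq_trans _ hall0) _.
    apply: subset_leq_card; apply/subsetP => p; rewrite !inE.
    by case/and3P=> /andP[-> ->] _ ->.
  apply: subset_leq_card; apply/subsetP => i; rewrite !inE.
  case/and3P=> /andP[-> Ii].
  by have := minx i Ii; rewrite Ii /=; lia.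
(* [[0, x)] contains no point of [I], hence no interval either. *)
have hqx : x <= h q.
  rewrite leqNgt; apply/negP => hx; have := hall 0 x (ltnW (ltn_ord x)).
  rewrite [X in _ <= X]eq_card0 => [|i].
    rewrite leqn0 cards_eq0 => /eqP/setP/(_ q).
    by rewrite !inE Pq hx.
  by rewrite !inE; apply/negP => /and3P[/minx]; lia.
have fI' p : p \in P -> p != q ->
    (f p != x) && (f p \in I) && (l p <= f p <= h p).
  by move=> Pp pq; have := fI p; rewrite !inE pq Pp => /(_ isT).
exists (fun p => if p == q then x else f p); split=> [p1 p2 P1 P2|p Pp].
  have [->|n1] := eqVneq p1 q; have [->|n2] := eqVneq p2 q => // fE.
  - by have := fI' p2 P2 n2; rewrite -fE eqxx.
  - by have := fI' p1 P1 n1; rewrite fE eqxx.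
  by apply: injf; rewrite // !inE ?n1 ?n2.
have [->|npq] := eqVneq p q; first by rewrite Ix lq.
by have /andP[/andP[_ ->] ->] := fI' p Pp npq.
Qed.

(** * Positroids as interval rank conditions *)

Lemma card_split (T : finType) (A : {set T}) (P : pred T) :
  #|A| = #|[set x in A | P x]| + #|[set x in A | ~~ P x]|.
Proof.
rewrite -(cardsID [set x | P x] A); congr (_ + _); apply: eq_card => x.
  by rewrite !inE.
by rewrite !inE andbC.
Qed.

Lemma in_sep (T : finType) (A : {set T}) (P : pred T) x :
  (x \in [set y in A | P y]) = (x \in A) && P x.
Proof. by rewrite inE. Qed.

Section Necklace.

Variables (n : nat) (w : decorated_perm n).
Let wV := (dperm w)^-1.
Local Notation I0 := (anti_exceedance w 0).

Lemma clockwise_fixed_inv i : clockwise_fixed w i -> wV i = i.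
Proof.
rewrite /clockwise_fixed; case: insubP => // [[j /= wj] _ <- _].
by rewrite -{1}(eqP wj) /wV permK.
Qed.

Lemma mem_anti_exceedance0 i : (i \in I0) = (i < wV i) || clockwise_fixed w i.
Proof. by rewrite !inE /cyc_lt !cyc_posE //= !subn0. Qed.

Lemma anti_exceedance0_le i : i \in I0 -> i <= wV i.
Proof.
by rewrite mem_anti_exceedance0 => /orP[/ltnW //|/clockwise_fixed_inv->].
Qed.

Lemma anti_exceedance0_ge i : i \notin I0 -> wV i <= i.
Proof. by rewrite mem_anti_exceedance0 negb_or -leqNgt => /andP[]. Qed.

(** Seen from the base point [r], an index below [r] is followed only by the
    indices between it and [r], while an index from [r] on is followed also by
    all those below [r]. *)
Lemma mem_anti_exceedance r i : r <= n ->
  (i \in anti_exceedance w r)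
  = if i < r then (i \in I0) && (wV i < r) else (i \in I0) || (wV i < r).
Proof.
move=> le_rn; rewrite mem_anti_exceedance0 !inE /cyc_lt !cyc_posE // -/wV.
have lt_in := ltn_ord i; have lt_jn := ltn_ord (wV i).
have [/clockwise_fixed_inv->|_] := boolP (clockwise_fixed w i).
  by rewrite !orbT /=; case: ltnP.
rewrite !orbF; case: (ltnP i r) => ir; case: (ltnP (wV i) r) => jr; lia.
Qed.

(** Passing from the base point 0 to [r] gains and loses equally many elements
    because [w^-1] is a bijection: as many [i] satisfy [w^-1 i < r] as satisfy
    [i < r]. *)
Lemma card_anti_exceedance r : r <= n -> #|anti_exceedance w r| = #|I0|.
Proof.
move=> le_rn; set Ir := anti_exceedance w r.
pose R : {set 'I_n} := [set i : 'I_n | i < r].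
pose L : {set 'I_n} := [set i | wV i < r].
have inIr i := mem_anti_exceedance i le_rn; rewrite -/Ir in inIr.
have inR (i : 'I_n) : (i \in R) = (i < r) by rewrite inE.
have inL i : (i \in L) = (wV i < r) by rewrite inE.
have LR : #|~: L| = #|~: R|.
  rewrite -(card_imset (~: R) (@perm_inj _ w)); apply: eq_card => i.
  rewrite !inE; apply/idP/imsetP => [ri|[j]].
    by exists (wV i); rewrite ?inE // /wV permKV.
  by rewrite !inE => rj ->; rewrite /wV permK.
have below : #|Ir :&: R| = #|I0 :&: L|.
  apply: eq_card => i; rewrite !in_setI inIr inR inL.
  case: (ltnP i r) => [_|ir]; first by rewrite andbT.
  rewrite andbF; apply/esym/negP => /andP[/anti_exceedance0_le]; lia.
have above : #|~: R :\: Ir| = #|~: L :\: I0|.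
  apply: eq_card => i; rewrite !in_setD inIr.
  rewrite !in_setC inR inL.
  case: (ltnP i r) => [ir|_]; last by rewrite negb_or andbT andbC.
  rewrite andbF; apply/esym/negP => /andP[/anti_exceedance0_ge]; lia.
have flip (A B : {set 'I_n}) : ~: A :&: B = B :\: A by rewrite setDE setIC.
have := cardsID R Ir; have := cardsID Ir (~: R).
have := cardsID L I0; have := cardsID I0 (~: L).
rewrite !flip below above LR.
lia.
Qed.

(** The first [n - r + b] indices from [r] on wrap around and form the
    complement of [[b, r)]. Complementing reverses the inequality. *)
Lemma gale_wrapping_window r b (I : {set 'I_n}) :
  b <= r -> r <= n -> #|I| = #|I0| ->
  (#|[set i in I | cyc_pos r i < n - r + b]|
     <= #|[set i in anti_exceedance w r | cyc_pos r i < n - r + b]|)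
  = (#|[set i in I0 | (b <= i) && (wV i < r)]| <= #|[set i in I | b <= i < r]|).
Proof.
move=> le_br le_rn; rewrite -(card_anti_exceedance le_rn) => eq_card_I.
have window (X : {set 'I_n}) :
    #|X| = #|[set i in X | cyc_pos r i < n - r + b]|
           + #|[set i in X | b <= i < r]|.
  rewrite (card_split X (fun i => cyc_pos r i < n - r + b)); congr (_ + _).
  apply: eq_card => i; rewrite !inE cyc_posE //; congr (_ && _).
  by have := ltn_ord i; case: (leqP r i); lia.
have -> : #|[set i in I0 | (b <= i) && (wV i < r)]|
          = #|[set i in anti_exceedance w r | b <= i < r]|.
  apply: eq_card => i; rewrite !in_sep ?in_setC (mem_anti_exceedance _ le_rn).
  have [ir|ri] := ltnP i r; first by rewrite andbT andbAC andbA.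
  rewrite !andbF; apply/negP => /and3P[/anti_exceedance0_le]; lia.
have := window I; have := window (anti_exceedance w r).
by rewrite eq_card_I; lia.
Qed.

(** The first [c - b] indices from [b] on form the interval [[b, c)]; the
    inequality is reversed by replacing both sets with their complements. *)
Lemma gale_straight_window b c (I : {set 'I_n}) : b <= c -> c <= n ->
  (#|[set i in I | cyc_pos b i < c - b]|
     <= #|[set i in anti_exceedance w b | cyc_pos b i < c - b]|)
  = (#|[set i in ~: I0 | (b <= wV i) && (i < c)]|
     <= #|[set i in ~: I | b <= i < c]|).
Proof.
move=> le_bc le_cn; have le_bn := leq_trans le_bc le_cn.
have window (X : {set 'I_n}) :
    #|[set i : 'I_n | b <= i < c]| = #|[set i in X | cyc_pos b i < c - b]|
           + #|[set i in ~: X | b <= i < c]|.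
  rewrite (card_split [set i : 'I_n | b <= i < c] (fun i => i \in X)).
  congr (_ + _); apply: eq_card => i.
    rewrite !inE cyc_posE // andbC; congr (_ && _).
    by have := ltn_ord i; case: (leqP b i); lia.
  by rewrite !inE andbC.
have -> : #|[set i in ~: I0 | (b <= wV i) && (i < c)]|
          = #|[set i in ~: anti_exceedance w b | b <= i < c]|.
  apply: eq_card => i; rewrite !in_sep ?in_setC (mem_anti_exceedance _ le_bn).
  have [ib|bi] := ltnP i b; last by rewrite negb_or -leqNgt -andbA.
  rewrite andbF; apply/negP => /and3P[/anti_exceedance0_ge]; lia.
have := window I; have := window (anti_exceedance w b); lia.
Qed.

Lemma positroidP k (I : {set 'I_n}) : dperm_rank w = k ->
  I \in positroid w k <->
  [/\ #|I| = k,
      forall b c, c <= n -> #|[set i in I0 | (b <= i) && (wV i < c)]|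
                            <= #|[set i in I | b <= i < c]|
    & forall b c, c <= n -> #|[set i in ~: I0 | (b <= wV i) && (i < c)]|
                            <= #|[set i in ~: I | b <= i < c]| ].
Proof.
rewrite /dperm_rank => I0k; rewrite inE.
split=> [/andP[/eqP Ik /forallP galeI] | [Ik hallI hallC]].
  (* The base point [n] gives the same cyclic order as the base point 0; with it
     the interval [[b, n)] is also the complement of an initial segment. *)
  have {}galeI r t : r <= n -> #|[set i in I | cyc_pos r i < t]|
      <= #|[set i in anti_exceedance w r | cyc_pos r i < t]|.
    rewrite leq_eqVlt => /orP[/eqP->|lt_rn]; last first.
      by have /gale_leP[] := galeI (Ordinal lt_rn).
    have [n0|n_gt0] := posnP n.
      by rewrite [X in X <= _]eq_card0 // => i; have := ltn_ord i; lia.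
    have /gale_leP[_ /(_ t) /=] := galeI (Ordinal n_gt0).
    have posn (i : 'I_n) : cyc_pos n i = cyc_pos 0 i.
      by rewrite /cyc_pos subnn addn0 subn0 modnDr.
    have -> : anti_exceedance w n = anti_exceedance w 0.
      by apply/setP => i; rewrite !inE /cyc_lt !posn.
    have posE (X : {set 'I_n}) :
        [set i in X | cyc_pos n i < t] = [set i in X | cyc_pos 0 i < t].
      by apply/setP => i; rewrite !inE posn.
    by rewrite !posE.
  split=> // b c le_cn; have [le_bc|lt_cb] := leqP b c.
  - by rewrite -gale_wrapping_window ?Ik ?galeI.
  - rewrite eq_card0 // => i; rewrite in_sep; apply/negP.
    by case/and3P=> /anti_exceedance0_le; lia.
  - by rewrite -gale_straight_window ?galeI // (leq_trans le_bc).
  rewrite eq_card0 // => i; rewrite in_sep in_setC; apply/negP.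
  by case/and3P=> /anti_exceedance0_ge; lia.
rewrite Ik eqxx; apply/forallP => r; have le_rn := ltnW (ltn_ord r).
apply/gale_leP; rewrite card_anti_exceedance // I0k Ik; split=> // t.
have [le_tn|lt_nt] := leqP t (n - r).
  have := hallC r (r + t); rewrite -gale_straight_window ?leq_addr //;
    last by lia.
  by rewrite addKn; apply; lia.
have [le_tn|le_nt] := leqP t n.
  have -> : t = n - r + (t - (n - r)) by lia.
  by rewrite gale_wrapping_window ?Ik ?hallI //; lia.
have whole (X : {set 'I_n}) : [set i in X | cyc_pos r i < t] = X.
  apply/setP => i; rewrite inE (leq_trans _ (ltnW le_nt)) ?andbT //.
  by rewrite ltn_mod; have := ltn_ord i; lia.
by rewrite !whole card_anti_exceedance // I0k Ik.
Qed.

End Necklace.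

(** * Permutations between the ends of a Grassmann interval *)

Lemma card_values_split n (y : 'S_n) m t : #|[set i : 'I_n | i < t]|
  = #|[set p : 'I_n | (p < m) && (y p < t)]|
  + #|[set p : 'I_n | (m <= p) && (y p < t)]|.
Proof.
rewrite -(card_preimset _ (@perm_inj _ y)).
rewrite (card_split (y @^-1: _) (fun p => p < m)).
by congr (_ + _); apply: eq_card => p; rewrite !inE andbC // -leqNgt.
Qed.

(** For initial sets of size at most [k] the pointwise inequalities on [p < k]
    suffice. For larger ones, the positions outside are counted instead: they
    are all at least [k], where the inequality is reversed, and so is the effect
    of complementing. *)
Lemma bruhat_le_pointwise n k (u v : 'S_n) :
  (forall p : 'I_n, p < k -> u p <= v p) ->
  (forall p : 'I_n, k <= p -> v p <= u p) ->
  bruhat_le u v.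
Proof.
move=> le_uv le_vu; apply/bruhat_leP => m t le_mn.
have [le_mk|lt_km] := leqP m k.
  apply: subset_leq_card; apply/subsetP => p; rewrite !inE => /andP[pm vt].
  by rewrite pm (leq_ltn_trans (le_uv p _) vt) // (leq_trans pm).
have : #|[set p : 'I_n | (m <= p) && (u p < t)]|
       <= #|[set p : 'I_n | (m <= p) && (v p < t)]|.
  apply: subset_leq_card; apply/subsetP => p; rewrite !inE => /andP[mp ut].
  by rewrite mp (leq_ltn_trans (le_vu p _) ut) // ltnW // (leq_trans lt_km).
by have := card_values_split u m t; have := card_values_split v m t; lia.
Qed.

Lemma down_closed_initial n (D : {set 'I_n}) :
  (forall p q : 'I_n, p < q -> q \in D -> p \in D) ->
  exists2 m, m <= n & forall p : 'I_n, (p \in D) = (p < m).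
Proof.
move=> downD; exists (\max_(q in D) q.+1); first by apply/bigmax_leqP.
move=> p; apply/idP/idP => [Dp|].
  exact: (@leq_bigmax_cond _ (fun q => q \in D) (fun q : 'I_n => q.+1)).
have [->|[q0 Dq0]] := set_0Vmem D; first by rewrite big_set0.
have [|q Dq ->] := @eq_bigmax_cond _ (mem D) (fun q : 'I_n => q.+1).
  by apply/card_gt0P; exists q0.
rewrite ltnS leq_eqVlt => /orP[/eqP/val_inj->|/downD]; first exact: Dq.
exact.
Qed.

(** Let [m] be the number of [p < k] with [v p < c]. By monotonicity these are
    the [p < m]; then [y <= v] at [m] forces [y p < c] for all [p < m], and
    [u <= y] at [m] says that at least as many of the [y p] as of the [u p] with
    [p < m] are at least [b]. *)
Lemma interval_count_below n k (u v y : 'S_n) b c :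
  (forall p q : 'I_n, p < q -> q < k -> v p < v q) ->
  bruhat_le u y -> bruhat_le y v ->
  #|[set p : 'I_n | (p < k) && ((b <= u p) && (v p < c))]|
  <= #|[set p : 'I_n | (p < k) && (b <= y p < c)]|.
Proof.
move=> mono_v /bruhat_leP le_uy /bruhat_leP le_yv.
have [m le_mn mE] :
    exists2 m, m <= n & forall p : 'I_n, (p < k) && (v p < c) = (p < m).
  have [|m le_mn mE] :=
    @down_closed_initial n [set p : 'I_n | (p < k) && (v p < c)].
    move=> p q pq; rewrite !inE => /andP[qk qc]; have := mono_v p q pq qk; lia.
  by exists m => // p; rewrite -mE inE.
have y_lt_c (p : 'I_n) : p < m -> y p < c.
  have sub :
      [set p : 'I_n | (p < m) && (y p < c)] \subset [set p : 'I_n | p < m].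
    by apply/subsetP => q; rewrite !inE => /andP[].
  have /eqP/setP/(_ p) :
      [set p : 'I_n | (p < m) && (y p < c)] == [set p : 'I_n | p < m].
    rewrite eqEcard sub; apply: leq_trans (le_yv m c le_mn).
    apply: subset_leq_card; apply/subsetP => q; rewrite !inE => qm.
    by rewrite qm; have := mE q; rewrite qm => /andP[].
  by rewrite !inE => + pm; rewrite pm.
have split_m (z : 'S_n) : #|[set p : 'I_n | p < m]|
    = #|[set p : 'I_n | (p < m) && (z p < b)]|
    + #|[set p : 'I_n | (p < m) && (b <= z p)]|.
  rewrite (card_split [set p : 'I_n | p < m] (fun p => z p < b)); congr (_ + _).
    by apply: eq_card => p; rewrite !inE.
  by apply: eq_card => p; rewrite !inE -leqNgt.
have lower : #|[set p : 'I_n | (p < m) && (b <= u p)]|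
             <= #|[set p : 'I_n | (p < m) && (b <= y p)]|.
  by have := le_uy m b le_mn; have := split_m u; have := split_m y; lia.
apply: leq_trans (leq_trans lower _);
  apply: subset_leq_card; apply/subsetP => p.
  by rewrite !inE -mE => /and3P[-> -> ->].
rewrite !inE => /andP[pm ->]; rewrite y_lt_c //.
by have := mE p; rewrite pm => /andP[->].
Qed.

(** The mirror image of [interval_count_below]: the [p >= k] with [b <= v p]
    form a final segment of positions. *)
Lemma interval_count_above n k (u v y : 'S_n) b c :
  (forall p q : 'I_n, k <= p -> p < q -> v p < v q) ->
  bruhat_le u y -> bruhat_le y v ->
  #|[set p : 'I_n | (k <= p) && ((b <= v p) && (u p < c))]|
  <= #|[set p : 'I_n | (k <= p) && (b <= y p < c)]|.
Proof.
move=> mono_v /bruhat_leP le_uy /bruhat_leP le_yv.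
have [m le_mn mE] :
    exists2 m, m <= n & forall p : 'I_n, (k <= p) && (b <= v p) = (m <= p).
  have [|m le_mn mE] :=
    @down_closed_initial n [set p : 'I_n | ~~ ((k <= p) && (b <= v p))].
    move=> p q pq; rewrite !inE; apply: contra => /andP[kp bp].
    have := mono_v p q kp pq; lia.
  by exists m => // p; rewrite (leqNgt m p) -mE inE negbK.
have y_ge_b (p : 'I_n) : m <= p -> b <= y p.
  have y0 : #|[set p : 'I_n | (m <= p) && (y p < b)]|
            <= #|[set p : 'I_n | (m <= p) && (v p < b)]|.
    have := le_yv m b le_mn.
    by have := card_values_split v m b; have := card_values_split y m b; lia.
  rewrite [X in _ <= X]eq_card0 ?leqn0 in y0; last first.
    by move=> q; rewrite inE -mE -andbA (leqNgt b) andNb andbF.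
  move: y0; rewrite cards_eq0 => /eqP/setP/(_ p).
  by rewrite !inE => + mp; rewrite mp => /negbT; rewrite -leqNgt.
have upper : #|[set p : 'I_n | (m <= p) && (u p < c)]|
             <= #|[set p : 'I_n | (m <= p) && (y p < c)]|.
  have := le_uy m c le_mn.
  by have := card_values_split u m c; have := card_values_split y m c; lia.
apply: leq_trans (leq_trans upper _);
  apply: subset_leq_card; apply/subsetP => p.
  by rewrite !inE -mE => /and3P[-> -> ->].
rewrite !inE => /andP[mp ->]; rewrite y_ge_b //.
by have := mE p; rewrite mp => /andP[->].
Qed.

Theorem theorem1p4 (n k : nat) (w : decorated_perm n) (hk : dperm_rank w = k)
    (u v : 'S_n) (huv : grassmann_interval k w u v) :
  positroid w k = [set initial_set y k | y in bruhat_interval u v].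
Proof.
case: huv => -[mono_lo mono_hi] v_k uE; set I0 := anti_exceedance w 0 in v_k *.
have wV_u p : (dperm w)^-1 (u p) = v p by rewrite uE permM permK.
have u_I0 p : (u p \in I0) = (p < k).
  have inj_wV := @perm_inj _ (dperm w)^-1.
  rewrite -(mem_imset _ _ inj_wV) -v_k wV_u /initial_set.
  by rewrite (mem_imset _ _ (@perm_inj _ v)) inE.
have initial_I (y : 'S_n) p : (y p \in initial_set y k) = (p < k).
  by rewrite (mem_imset _ _ (@perm_inj _ y)) inE.
have card_via (y : 'S_n) (A : {set 'I_n}) : #|A| = #|[set p | y p \in A]|.
  by rewrite -(card_preimset _ (@perm_inj _ y)).
apply/setP => I; apply/idP/imsetP => [/(positroidP _ hk)[Ik hallI hallC]|].
  have [f [inj_f fP]] := interval_matching (l := id) hallI.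
  have [g [inj_g gP]] := interval_matching (h := id) hallC.
  pose z i := if i \in I0 then f i else g i.
  have z_I i : (z i \in I) = (i \in I0).
    rewrite /z; case: ifPn => [/fP/andP[]//|I0'i].
    by have := gP i; rewrite !in_setC I0'i => /(_ isT)/andP[/negPf].
  have inj_z : injective z.
    move=> i j eq_z; have := z_I i; rewrite eq_z z_I; move: eq_z; rewrite /z.
    case: ifPn => I0i; case: ifPn => I0j // eq_z _; first exact: inj_f.
    by apply: inj_g; rewrite ?in_setC.
  pose y : 'S_n := u * perm inj_z.
  have yE p : y p = z (u p) by rewrite permM permE.
  have y_lo (p : 'I_n) : p < k -> u p <= y p <= v p.
    by rewrite yE /z -u_I0 => I0p; rewrite I0p -wV_u; have /andP[] := fP _ I0p.
  have y_hi (p : 'I_n) : k <= p -> v p <= y p <= u p.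
    rewrite yE /z leqNgt -u_I0 => I0'p; rewrite (negPf I0'p) -wV_u.
    by have := gP (u p); rewrite in_setC => /(_ I0'p)/andP[].
  exists y; last first.
    apply/setP => i; rewrite -[i](permKV y) initial_I yE z_I u_I0.
    by [].
  rewrite inE; apply/andP; split; apply: (@bruhat_le_pointwise _ k) => p pk.
  - by have /andP[] := y_lo p pk.
  - by have /andP[] := y_hi p pk.
  - by have /andP[] := y_lo p pk.
  - by have /andP[] := y_hi p pk.
case=> y; rewrite inE => /andP[le_uy le_yv] ->; apply/(positroidP _ hk).
split=> [|b c _|b c _].
- transitivity #|I0|; last exact: hk.
  rewrite (card_via y) (card_via u I0).
  by apply: eq_card => p; rewrite [LHS]in_set [RHS]in_set initial_I u_I0.
- rewrite (card_via y [set i in initial_set y k | _]) (card_via u).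
  have := interval_count_below b c mono_lo le_uy le_yv.
  congr (_ <= _); apply: eq_card => p; rewrite [LHS]in_set [RHS]in_set in_sep.
    by rewrite u_I0 wV_u.
  by rewrite initial_I.
rewrite (card_via y [set i in ~: initial_set y k | _]) (card_via u).
have := interval_count_above b c mono_hi le_uy le_yv.
congr (_ <= _); apply: eq_card => p.
  by rewrite [LHS]in_set [RHS]in_set in_sep in_setC u_I0 wV_u -leqNgt.
by rewrite [LHS]in_set [RHS]in_set in_sep in_setC initial_I -leqNgt.
Qed.
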